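(* Let $\alpha\in[0,1)$ and let $G$ be a strongly connected digraph with $n$ vertices. Then $$\lambda_\alpha(G)\leq\max\left\{\frac{\alpha(d_i^++d_j^+)+\sqrt{\alpha^2(d_i^+-d_j^+)^2+4(1-\alpha)^2m_i^+m_j^+}}{2} : (v_i, v_j)\in E(G)\right\},$$ and if $G$ is an outdegree regular digraph or an outdegree semiregular bipartite digraph, then equality holds.
   Context: Digraphs are finite, have no loops and no two arcs with the same tail and the same head (pairs of opposite arcs are allowed). For a digraph $G$ with vertices $v_1,\dots,v_n$ and arc set $E(G)$, $A(G)$ is the adjacency matrix, $d_i^+$ is the outdegree of $v_i$, and $D(G)=\mathrm{diag}(d_1^+,\dots,d_n^+)$. The $A_\alpha$ matrix is $A_\alpha(G)=\alpha D(G)+(1-\alpha)A(G)$, and $\lambda_\alpha(G)$ is the eigenvalue of $A_\alpha(G)$ of largest modulus (the Perron root when $G$ is strongly connected). Strongly connected: there is a directed path from every vertex to every other vertex. The 2-outdegree of $v_i$ is $T_i^+=\sum_{(v_i,v_j)\in E(G)}d_j^+$ and the average 2-outdegree is $m_i^+=T_i^+/d_i^+$. A digraph is outdegree regular if all vertices have the same outdegree. A bipartite digraph with bipartition $(V_1,V_2)$ (every arc has one end in $V_1$ and one in $V_2$) is outdegree semiregular if all vertices in $V_1$ have the same outdegree and all vertices in $V_2$ have the same outdegree. *)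

(* Defs.v *)
From HB Require Import structures.
From mathcomp Require Import all_boot all_order all_algebra.
From mathcomp Require Import boolp classical_sets reals.
From mathcomp Require Import polyrcf complex.
From mathcomp Require Import ring lra.

Set Implicit Arguments.
Unset Strict Implicit.
Unset Printing Implicit Defensive.

Import Order.TTheory GRing.Theory Num.Theory.
Local Open Scope ring_scope.

Record digraph (n : nat) := Digraph {
  arc :> rel 'I_n ;
  arc_irr : irreflexive arc
}.

Section Digraph.
Variables (n : nat) (G : digraph n).

Definition strongly_connected : Prop := forall i j : 'I_n, connect G i j.

Definition outdeg (i : 'I_n) : nat := #|[set j | G i j]%SET|.

Definition outdeg2 (i : 'I_n) : nat := (\sum_(j | G i j) outdeg j)%N.

Definition outdegree_regular : Prop :=
  forall i j : 'I_n, outdeg i = outdeg j.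

(* The bipartition is (V1, ~: V1). *)
Definition outdegree_semiregular_bipartite : Prop :=
  exists V1 : {set 'I_n},
    [/\ forall i j, G i j -> (i \in V1) != (j \in V1),
        {in V1 &, forall i j, outdeg i = outdeg j} &
        {in ~: V1 &, forall i j, outdeg i = outdeg j}].

End Digraph.

Section Aalpha.
Variables (R : realType) (n : nat).
Implicit Types (alpha : R) (G : digraph n).

Definition adjmx G : 'M[R]_n := \matrix_(i, j) (G i j)%:R.

Definition outdegmx G : 'M[R]_n := diag_mx (\row_i (outdeg G i)%:R).

Definition Aalpha alpha G : 'M[R]_n :=
  alpha *: outdegmx G + (1 - alpha) *: adjmx G.

Definition avg_outdeg2 G (i : 'I_n) : R := (outdeg2 G i)%:R / (outdeg G i)%:R.

Definition arc_bound alpha G (i j : 'I_n) : R :=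
  let di := (outdeg G i)%:R in
  let dj := (outdeg G j)%:R in
  (alpha * (di + dj)
   + Num.sqrt (alpha ^+ 2 * (di - dj) ^+ 2
               + 4 * (1 - alpha) ^+ 2 * avg_outdeg2 G i * avg_outdeg2 G j)) / 2.

(* All the values [arc_bound] are nonnegative when [0 <= alpha], so the        *)
(* neutral element 0 does not change the maximum of a nonempty set of arcs.    *)
Definition max_arc_bound alpha G : R :=
  \big[Num.max/0]_(e : 'I_n * 'I_n | G e.1 e.2) arc_bound alpha G e.1 e.2.

End Aalpha.

(* The modulus of a complex number is real but typed in R[i], hence the        *)
(* injection of lam in the comparison. Several eigenvalues may have the        *)
(* largest modulus (consider a directed cycle and alpha = 0); asking that lam  *)
(* itself bounds all the moduli singles out the Perron root among them.        *)
Definition is_perron_root (R : rcfType) n (A : 'M[R]_n) (lam : R) : Prop :=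
  let AC := map_mx (real_complex R) A in
  eigenvalue AC lam%:C%C /\
  forall mu : R[i], eigenvalue AC mu -> `|mu| <= lam%:C%C.

(* For 0 <= alpha < 1 the default value 0 is only reached when n = 0, by       *)
(* [lambda_alphaP] below.                                                      *)
Definition lambda_alpha (R : realType) n (alpha : R) (G : digraph n) : R :=
  xget 0 [set lam : R | is_perron_root (Aalpha alpha G) lam]%classic.

Lemma is_perron_root_inj (R : rcfType) n (A : 'M[R]_n) (l1 l2 : R) :
  is_perron_root A l1 -> is_perron_root A l2 -> l1 = l2.
Proof.
have le12 (k1 k2 : R) : is_perron_root A k1 -> is_perron_root A k2 -> k1 <= k2.
  move=> [e1 _] [_ m2]; rewrite -lecR; apply: le_trans (m2 _ e1).
  by apply: real_ler_norm; apply/complex_realP; exists k1.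
by move=> p1 p2; apply/le_anti; rewrite !le12.
Qed.

Lemma seq_argmax (R : rcfType) (T : eqType) (f : T -> R) (x : T) (s : seq T) :
  exists2 m, m \in x :: s & forall r, r \in x :: s -> f r <= f m.
Proof.
elim: s x => [|y s IH] x; first by exists x => [|r]; rewrite inE// => /eqP ->.
have [m ms mmax] := IH y; have [xm|mx] := leP (f x) (f m).
  exists m => [|r]; first by rewrite inE ms orbT.
  by rewrite inE => /predU1P[->//|/mmax].
exists x => [|r]; first by rewrite mem_head.
by rewrite inE => /predU1P[->//|/mmax rm]; exact: le_trans rm (ltW mx).
Qed.

Lemma subinvariant_root (R : rcfType) n (A : 'M[R]_n.+1) (y : 'rV[R]_n.+1)
    (s : R) :
  (forall i j, 0 <= A i j) -> (forall i, 0 <= y 0 i) -> y != 0 ->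
  (forall i, s * y 0 i <= (y *m A) 0 i) ->
  exists2 t, s <= t & root (char_poly A) t.
Proof.
move=> A0 y0 yn0 hy; apply: contrapT => noroot.
have chi0 t : s <= t -> (char_poly A).[t] != 0.
  by move=> st; apply/negP => rt; apply: noroot; exists t.
have [q qE] : exists q : 'I_n.+1 -> {poly R}, forall t i,
    t * (q i).[t] = \sum_j (q j).[t] * A j i + (char_poly A).[t] ^+ 2.
  have [pv pvE] : exists pv : 'rV_n.+1,
      pv *m char_poly_mx A = char_poly A *: const_mx 1.
    exists (const_mx 1 *m \adj (char_poly_mx A)).
    by rewrite -mulmxA mul_adj_mx mul_mx_scalar.
  exists (fun i => pv 0 i * char_poly A) => t i.
  move/rowP/(_ i): pvE; rewrite !mxE.
  move: (char_poly A) => chi.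
  move/(congr1 (fun p : {poly R} => p.[t] * chi.[t])).
  rewrite hornerM hornerE mulr1 -expr2 => <-.
  rewrite horner_sum mulr_suml -big_split/=.
  rewrite [RHS](bigD1 i)//= big1 => [|j /negPf ji].
    by rewrite !mxE eqxx mulr1n !hornerE /=; ring.
  by rewrite !mxE ji mulr0n !hornerE /=; ring.
have chi2 t : s <= t -> 0 < (char_poly A).[t] ^+ 2.
  by move=> st; rewrite exprn_even_gt0//= chi0.
pose T : R := `|s| + 1 + \sum_i \sum_j A j i.
have sT : s < T.
  rewrite /T; have := ler_norm s.
  have : 0 <= \sum_i \sum_j A j i by do 2 apply: sumr_ge0 => ? _.
  by lra.
have qT i : 0 < (q i).[T].
  pose k := [arg min_(k < i) (q k).[T]]%O.
  have kmin j : (q k).[T] <= (q j).[T].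
    by rewrite /k; case: arg_minP => // k' _ /(_ j) ->.
  apply: lt_le_trans (kmin i).
  have := qE T k.
  have : (\sum_j A j k) * (q k).[T] <= \sum_j (q j).[T] * A j k.
    rewrite mulr_suml; apply: ler_sum => j _.
    by rewrite mulrC ler_wpM2r.
  have := chi2 _ (ltW sT).
  have colk : \sum_j A j k < T.
    rewrite /T [X in _ < _ + X](bigD1 k)//=.
    have : 0 <= \sum_(i0 < n.+1 | i0 != k) \sum_j A j i0.
      by do 2 apply: sumr_ge0 => ? _.
    by have := normr_ge0 s; lra.
  move=> h1 h2 h3; rewrite ltNge; apply/negP => qk.
  have : (T - \sum_j A j k) * (q k).[T] <= 0.
    by rewrite mulr_ge0_le0// subr_ge0 ltW.
  by rewrite mulrBl; lra.
pose Q := \prod_i q i.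
have QE t : (Q.[t] == 0) = [exists i, (q i).[t] == 0].
  rewrite horner_prod prodf_seq_eq0; apply/hasP/existsP => [[i _ ?]|[i ?]].
    by exists i.
  by exists i => //; rewrite mem_index_enum.
have Q0 : Q != 0.
  apply/negP => /eqP Q0.
  have : Q.[T] == 0 by rewrite Q0 horner0.
  by rewrite QE => /existsP[k]; rewrite gt_eqF.
have [t0 [st0 t0T t0s noQ]] : exists t0, [/\ s <= t0, t0 < T,
    t0 != s -> Q.[t0] = 0 & forall t, t0 < t -> t < T -> Q.[t] != 0].
  pose rs := [seq r <- roots Q (s - 1) T | s <= r].
  have rsP r : r \in rs -> [/\ s <= r, r < T & Q.[r] = 0].
    rewrite mem_filter => /andP[-> rQ]; have := roots_in rQ.
    by rewrite in_itv/= => /andP[_ ->]; move/root_roots/rootP: rQ => ->.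
  have [t0 t0rs t0max] := seq_argmax id s rs.
  exists t0; split; first by rewrite t0max// mem_head.
  - by move: t0rs; rewrite inE => /predU1P[->//|/rsP[]].
  - by move=> /negPf t0s; move: t0rs; rewrite inE t0s => /rsP[].
  - move=> t t0t tT; apply/negP => Qt.
    have st : s <= t by apply: le_trans (ltW t0t); rewrite t0max// mem_head.
    move: t0t; rewrite ltNge => /negP; apply.
    apply: t0max; rewrite inE mem_filter st in_roots Q0 /root Qt in_itv/= tT.
    by rewrite (lt_le_trans _ st) ?orbT// ltrBlDr ltrDl.
have qt0 i : 0 <= (q i).[t0].
  rewrite leNgt; apply/negP => qneg.
  have /(@poly_ivt R (q i) _ _ (ltW t0T))[t /andP[h1 h2]] :
      (q i).[t0] <= 0 <= (q i).[T] by rewrite !ltW.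
  rewrite /root => /eqP qt.
  have tT : t != T by apply: contraTneq (qT i) => <-; rewrite qt ltxx.
  have tt0 : t0 != t by apply: contraTneq qneg => ->; rewrite qt ltxx.
  have := noQ t; rewrite !lt_neqAle tt0 h1 tT h2 => /(_ isT isT)/negP; apply.
  by rewrite QE; apply/existsP; exists i; rewrite qt.
have qpos i : 0 < (q i).[t0].
  rewrite lt_neqAle qt0 andbT; apply/eqP => qi0.
  have := qE t0 i; rewrite -qi0 mulr0 => /esym/eqP.
  rewrite gt_eqF// ltr_wpDl ?chi2// sumr_ge0// => j _.
  by rewrite mulr_ge0.
have {}t0s : t0 = s.
  apply/eqP/contraT => /t0s/eqP; rewrite QE => /existsP[k].
  by rewrite gt_eqF.
pose x i := (q i).[s].
have xpos i : 0 < x i by rewrite /x -t0s.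
have xA i : \sum_j x j * A j i < s * x i.
  by rewrite qE ltrDl chi2.
pose k := [arg max_(k > 0) (y 0 k / x k)]%O.
have kmax j : y 0 j / x j <= y 0 k / x k.
  by rewrite /k; case: arg_maxP => // k' _; apply.
pose c := y 0 k / x k.
have yc j : y 0 j <= c * x j by rewrite -ler_pdivrMr// kmax.
have ck : y 0 k = c * x k by rewrite /c divfK ?gt_eqF.
have c0 : 0 < c.
  have [j yj] : exists j, y 0 j != 0 by apply/rV0Pn.
  apply: lt_le_trans (kmax j); rewrite divr_gt0//.
  by rewrite lt_neqAle eq_sym yj y0.
have := hy k; rewrite mxE leNgt => /negP; apply.
rewrite ck mulrCA (@le_lt_trans _ _ (c * \sum_j x j * A j k))//.
  rewrite mulr_sumr ler_sum// => j _.
  by rewrite mulrA ler_wpM2r.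
by rewrite ltr_pM2l.
Qed.

(* Perron-Frobenius: a nonnegative matrix has a Perron root. *)
Lemma perron_root_exists (R : rcfType) n (A : 'M[R]_n) :
  (0 < n)%N -> (forall i j, 0 <= A i j) -> exists lam, is_perron_root A lam.
Proof.
case: n A => // n A _ A0.
set AC := map_mx (real_complex R) A.
have [rs rsE] := closed_field_poly_normal (char_poly AC).
have evE mu : eigenvalue AC mu = (mu \in rs).
  by rewrite eigenvalue_root_char rsE rootZ ?lead_coef_eq0 ?root_prod_XsubC//
     monic_neq0// char_poly_monic.
have [mu murs mumax] : exists2 mu, mu \in rs &
    forall nu, nu \in rs -> Normc.normc nu <= Normc.normc mu.
  have : size (char_poly AC) = n.+2 by rewrite size_char_poly.
  rewrite rsE (monicP (char_poly_monic _)) scale1r size_prod_XsubC.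
  case: rs {rsE evE} => // r rs _.
  by have [mu] := seq_argmax (@Normc.normc R) r rs; exists mu.
have /eigenvalueP[v vE vn0] : eigenvalue AC mu by rewrite evE.
pose y : 'rV[R]_n.+1 := \row_i Normc.normc (v 0 i).
have normE z : `|z| = (Normc.normc z)%:C%C by case: z.
have [||||t st rt] := @subinvariant_root R n A y (Normc.normc mu).
- exact: A0.
- by move=> i; rewrite mxE -ler0c -normE.
- apply: contraNneq vn0 => y0; apply/eqP/rowP => i; rewrite mxE.
  by apply: Normc.eq0_normc; move/rowP/(_ i): y0; rewrite !mxE.
- move=> i; rewrite !mxE -Normc.normcM -lecR.
  move/rowP/(_ i): vE; rewrite !mxE => <-.
  rewrite -normE rmorph_sum/= (le_trans (ler_norm_sum _ _ _))// ler_sum// => j _.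
  by rewrite normrM !mxE rmorphM /= normE [X in _ * X]ger0_norm ?ler0c.
have et : eigenvalue AC t%:C%C.
  by rewrite eigenvalue_root_char -map_char_poly fmorph_root.
exists t; split=> // nu; rewrite evE => nurs.
by rewrite normE lecR (le_trans (mumax _ nurs)).
Qed.

Lemma lambda_alphaP (R : realType) n (alpha : R) (G : digraph n) :
  (0 < n)%N -> 0 <= alpha < 1 ->
  is_perron_root (Aalpha alpha G) (lambda_alpha alpha G).
Proof.
move=> n0 /andP[a0 a1]; apply: xgetPex; apply: perron_root_exists => // i j.
by rewrite !mxE addr_ge0// mulr_ge0// ?subr_ge0 ?(ltW a1)// mulrn_wge0.
Qed.

(* Main.v *)
Require Import Defs.
From mathcomp Require Import all_boot all_order all_algebra.
From mathcomp Require Import reals.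
From mathcomp Require Import classical_sets complex.
From mathcomp Require Import ring lra.

Set Implicit Arguments.
Unset Strict Implicit.
Unset Printing Implicit Defensive.

Import Order.TTheory GRing.Theory Num.Theory.
Local Open Scope ring_scope.

(** Conjugating [A_alpha] by the diagonal matrix of outdegrees turns its
    off-diagonal row sums into [(1 - alpha) m_i], so a right eigenvector [z]
    for [lambda] is studied through [y_i = |z_i| / d_i]. Take [i] maximising
    [y] and [j] maximising [y] among the out-neighbours of [i]. Then
    [(lambda - alpha d_i) y_i <= (1 - alpha) m_i y_j] and
    [(lambda - alpha d_j) y_j <= (1 - alpha) m_j y_i]; multiplying bounds
    [lambda] by the larger root of
    [(t - alpha d_i) (t - alpha d_j) = (1 - alpha)^2 m_i m_j], which is the
    bound attached to the arc [(i, j)].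
    In the two extremal cases every arc bound is itself an eigenvalue, with an
    eigenvector that is constant, respectively constant on both parts. *)

(** * The quadratic equation behind an arc bound *)

Section LargerRoot.
Variable R : rcfType.
Implicit Types a b c t : R.

(** The square root is at least [|a - b|], so the larger root of [(X - a) (X - b) = c] lies above
    both [a] and [b]; beyond it the product exceeds [c]. *)
Lemma larger_root_ge a b c t : 0 <= c ->
  (a < t -> b < t -> (t - a) * (t - b) <= c) ->
  t <= (a + b + Num.sqrt ((a - b) ^+ 2 + 4 * c)) / 2.
Proof.
move=> c0 tc; set s := Num.sqrt _.
have D0 : 0 <= (a - b) ^+ 2 + 4 * c by have := sqr_ge0 (a - b); lra.
have s2 : s ^+ 2 = (a - b) ^+ 2 + 4 * c by rewrite sqr_sqrtr.
have s0 : 0 <= s by exact: sqrtr_ge0.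
rewrite leNgt; apply/negP => ts.
have lt_at : a < t by nra.
have lt_bt : b < t by nra.
have := tc lt_at lt_bt; nra.
Qed.

Lemma larger_root_eq a b c : 0 <= c ->
  let r := (a + b + Num.sqrt ((a - b) ^+ 2 + 4 * c)) / 2 in
  (r - a) * (r - b) = c.
Proof.
move=> c0 r; rewrite {}/r; set s := Num.sqrt _.
have s2 : s ^+ 2 = (a - b) ^+ 2 + 4 * c.
  by rewrite sqr_sqrtr//; have := sqr_ge0 (a - b); lra.
by nra.
Qed.

End LargerRoot.

Lemma eigenvalue_trmx (F : fieldType) n (A : 'M[F]_n) a :
  eigenvalue A^T a = eigenvalue A a.
Proof.
rewrite /eigenvalue /eigenspace -(tr_scalar_mx n a) -linearB/=.
by rewrite !kermx_eq0 /row_free mxrank_tr tr_scalar_mx.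
Qed.

(** Perron roots are defined through complex eigenvalues; the rest of the argument works with real
    ones only. *)
Lemma is_perron_root_real (R : rcfType) n (A : 'M[R]_n) lam :
  is_perron_root A lam ->
  [/\ eigenvalue A lam, 0 <= lam & forall mu, eigenvalue A mu -> mu <= lam].
Proof.
move=> [elam lam_max]; split.
- by rewrite -(eigenvalue_map (real_complex R)).
- by rewrite -ler0c; exact: le_trans (lam_max _ elam).
- move=> mu emu; rewrite -lecR.
  apply: (le_trans (y := `|mu%:C%C|)).
    by apply: real_ler_norm; apply/complex_realP; exists mu.
  by apply: lam_max; rewrite (eigenvalue_map (real_complex R)).
Qed.

(** * Outdegrees and strong connectivity *)

Section Digraph.
Variables (n : nat) (G : digraph n).

Lemma outdegE (i : 'I_n) : outdeg G i = #|[pred j | G i j]|.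
Proof. by rewrite /outdeg cardsE. Qed.

Lemma arc_outdeg_gt0 (i j : 'I_n) : G i j -> (0 < outdeg G i)%N.
Proof. by move=> Gij; rewrite outdegE; apply/card_gt0P; exists j. Qed.

Lemma strongly_connected_outdeg_gt0 (i j : 'I_n) :
  strongly_connected G -> i != j -> (0 < outdeg G i)%N.
Proof.
move=> hG ij; have /connectP[[|k p] /= Gp jE] := hG i j.
  by rewrite jE eqxx in ij.
by have /andP[/arc_outdeg_gt0] := Gp.
Qed.

Lemma sum_out_const (V : nmodType) (i : 'I_n) (f : 'I_n -> V) (c : V) :
  (forall j, G i j -> f j = c) -> \sum_(j | G i j) f j = c *+ outdeg G i.
Proof.
by move=> fc; rewrite (eq_bigr (fun=> c))// outdegE -sumr_const.
Qed.

End Digraph.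

(** * Eigenvalues of [Aalpha] against the arc bounds *)

Section Aalpha.
Variables (R : realType) (n : nat) (alpha : R) (G : digraph n).
Local Notation d i := ((outdeg G i)%:R : R).
Local Notation m i := (avg_outdeg2 R G i).

(** [eigenvalue] refers to row vectors; passing to the transpose gives column eigenvectors, whose
    equation at [i] sums over the out-neighbours of [i]. *)
Lemma Aalpha_eigenvalueP (lam : R) :
  reflect (exists2 x : 'I_n -> R, exists i, x i != 0 & forall i,
             lam * x i = alpha * d i * x i + (1 - alpha) * \sum_(j | G i j) x j)
          (eigenvalue (Aalpha alpha G) lam).
Proof.
have mulE (v : 'rV[R]_n) i : (v *m (Aalpha alpha G)^T) 0 i =
    alpha * d i * v 0 i + (1 - alpha) * \sum_(j | G i j) v 0 j.
  rewrite mxE; under eq_bigr do rewrite !mxE mulrDr.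
  rewrite big_split /=; congr (_ + _).
    rewrite (bigD1 i)//= big1 => [|j /negPf ji].
      by rewrite eqxx mulr1n addr0 mulrC.
    by rewrite eq_sym ji mulr0n !mulr0.
  rewrite [in RHS]big_mkcond mulr_sumr; apply: eq_bigr => j _.
  by rewrite mulrCA; case: (G i j); rewrite ?mulr1 ?mulr0.
rewrite -eigenvalue_trmx; apply: (iffP eigenvalueP).
  move=> [v vE /rV0Pn v0]; exists (fun i => v 0 i) => // i.
  by rewrite -mulE vE mxE.
move=> [x [k xk] xE]; exists (\row_i x i).
  by apply/rowP => i; rewrite mulE !mxE xE; under eq_bigr do rewrite mxE.
by apply/rV0Pn; exists k; rewrite mxE.
Qed.

Lemma avg_outdeg2_ge0 i : 0 <= m i.
Proof. exact: divr_ge0. Qed.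

Lemma avg_outdeg2_const i (k : nat) : (0 < outdeg G i)%N ->
  (forall j, G i j -> outdeg G j = k) -> m i = k%:R.
Proof.
move=> di0 dk; rewrite /avg_outdeg2 /outdeg2 (eq_bigr _ dk) sum_nat_const.
by rewrite -outdegE natrM mulrAC divff ?mul1r// pnatr_eq0 -lt0n.
Qed.

Lemma arc_boundE i j : arc_bound alpha G i j =
  (alpha * d i + alpha * d j
   + Num.sqrt ((alpha * d i - alpha * d j) ^+ 2
               + 4 * ((1 - alpha) ^+ 2 * (m i * m j)))) / 2.
Proof.
by rewrite /arc_bound mulrDr -mulrBr exprMn !mulrA.
Qed.

Lemma max_arc_bound_ge0 : 0 <= max_arc_bound alpha G.
Proof. exact: bigmax_ge_id. Qed.

Lemma arc_bound_le_max i j :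
  G i j -> arc_bound alpha G i j <= max_arc_bound alpha G.
Proof.
by move=> Gij; apply: (bigmax_sup (i, j)).
Qed.

Lemma eigenvalue_le_max_arc_bound (lam : R) :
  0 <= alpha < 1 -> (forall i, 0 < outdeg G i)%N ->
  eigenvalue (Aalpha alpha G) lam -> lam <= max_arc_bound alpha G.
Proof.
move=> /andP[a0 a1] dgt0 /Aalpha_eigenvalueP[z [k zk] zE].
have d0 i : 0 < d i by rewrite ltr0n.
have a1' : 0 < 1 - alpha by rewrite subr_gt0.
pose y i := `|z i| / d i.
have yE i : `|z i| = y i * d i by rewrite /y divfK// gt_eqF.
have y0 i : 0 <= y i by rewrite divr_ge0.
(* Take moduli in the eigenvalue equation at [i]: each [|z j|] is at most [c * d j], and the [d j]
   add up to [m i * d i]. *)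
have step i c : (forall j, G i j -> y j <= c) ->
    (lam - alpha * d i) * y i <= (1 - alpha) * m i * c.
  move=> yc; rewrite -(ler_pM2r (d0 i)) -[leLHS]mulrA -yE.
  have -> : (1 - alpha) * m i * c * d i = (1 - alpha) * ((outdeg2 G i)%:R * c).
    by rewrite /avg_outdeg2; field; rewrite gt_eqF.
  have zi : (lam - alpha * d i) * z i = (1 - alpha) * \sum_(j | G i j) z j.
    by rewrite mulrBl zE; ring.
  apply: le_trans (ler_norm _) _; rewrite normrM normr_id -normrM zi normrM.
  rewrite (gtr0_norm a1') ler_pM2l//.
  apply: le_trans (ler_norm_sum _ _ _) _.
  rewrite /outdeg2 natr_sum mulr_suml ler_sum// => j Gij.
  by rewrite yE mulrC ler_pM2l// yc.
pose i := [arg max_(i > k) y i]%O.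
have ymax j : y j <= y i by rewrite /i; case: arg_maxP => // l _; apply.
have yi0 : 0 < y i.
  by apply: lt_le_trans (ymax k); rewrite divr_gt0// normr_gt0.
have [j0 Gij0] : exists j, G i j.
  by have := dgt0 i; rewrite outdegE => /card_gt0P.
have [j Gij yj] : exists2 j, G i j & forall l, G i l -> y l <= y j.
  by case: (arg_maxP y Gij0) => j; exists j.
apply: le_trans (arc_bound_le_max Gij); rewrite arc_boundE.
apply: larger_root_ge => [|ilam jlam].
  by rewrite mulr_ge0 ?sqr_ge0// mulr_ge0// avg_outdeg2_ge0.
have hi := step i (y j) yj.
have hj := step j (y i) (fun l _ => ymax l).
(* Were [y j] zero, [hi] would contradict [ilam]. *)
have yj0 : 0 < y j.
  rewrite lt_neqAle y0 andbT; apply/negP => /eqP yj0.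
  by move: hi; rewrite -yj0 mulr0 leNgt mulr_gt0// subr_gt0.
rewrite -(ler_pM2r (mulr_gt0 yi0 yj0)).
have pi0 : 0 <= (lam - alpha * d i) * y i by rewrite mulr_ge0// subr_ge0 ltW.
have pj0 : 0 <= (lam - alpha * d j) * y j by rewrite mulr_ge0// subr_ge0 ltW.
have := ler_pM pi0 pj0 hi hj.
rewrite mulrACA => /le_trans; apply.
by rewrite le_eqVlt; apply/orP; left; apply/eqP; ring.
Qed.

(** With constant outdegree [d], every arc bound collapses to [d], the common row sum. *)
Lemma regular_arc_bound_eigenvalue i j : alpha < 1 ->
  outdegree_regular G -> G i j ->
  eigenvalue (Aalpha alpha G) (arc_bound alpha G i j).
Proof.
move=> a1 reg Gij; have mE k : m k = d i.
  apply: avg_outdeg2_const => [|l _]; last exact: reg.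
  by rewrite (reg k i) (arc_outdeg_gt0 Gij).
apply/Aalpha_eigenvalueP; exists (fun=> 1) => [|k].
  by exists i; rewrite oner_eq0.
rewrite (sum_out_const (c := 1))// arc_boundE !mE (reg j i) (reg k i).
have -> : (alpha * d i - alpha * d i) ^+ 2
    + 4 * ((1 - alpha) ^+ 2 * (d i * d i)) = (2 * (1 - alpha) * d i) ^+ 2.
  by ring.
have a1' : 0 <= 1 - alpha by rewrite subr_ge0 ltW.
by rewrite sqrtr_sqr ger0_norm ?mulr_ge0//; field.
Qed.

Lemma semiregular_arc_bound_eigenvalue i j : alpha < 1 ->
  outdegree_semiregular_bipartite G -> G i j -> (0 < outdeg G j)%N ->
  eigenvalue (Aalpha alpha G) (arc_bound alpha G i j).
Proof.
move=> a1 [V1 [bip reg1 reg2]] Gij dj0.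
have di0 := arc_outdeg_gt0 Gij.
have degE k l : (k \in V1) = (l \in V1) -> outdeg G k = outdeg G l.
  move=> kl; have [lV|lV] := boolP (l \in V1).
    by apply: reg1; rewrite ?kl.
  by apply: reg2; rewrite inE ?kl.
have other k l p : G k l -> (k \in V1) != (p \in V1) -> (l \in V1) = (p \in V1).
  by move=> /bip; do 3 case: (_ \in V1).
have ij := bip _ _ Gij.
have mi : m i = d j.
  by apply: avg_outdeg2_const => // l Gil; apply: degE; exact: other Gil ij.
have mj : m j = d i.
  apply: avg_outdeg2_const => // l Gjl; apply: degE.
  by apply: other Gjl _; rewrite eq_sym.
set r := arc_bound _ _ _ _.
(* This is the singularity condition of the 2 by 2 system satisfied by vectors constant on both
   parts. *)
have rE : (r - alpha * d i) * (r - alpha * d j) = (1 - alpha) ^+ 2 * (d i * d j).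
  rewrite /r arc_boundE larger_root_eq ?mi ?mj ?[d j * _]mulrC//.
  by rewrite !mulr_ge0// subr_ge0 ltW.
apply/Aalpha_eigenvalueP.
(* These two values solve the equation on the part of [i] identically; on the other part the
   equation becomes [rE]. *)
exists (fun k => if (k \in V1) == (i \in V1) then (1 - alpha) * d i
                 else r - alpha * d i).
  by exists i; rewrite eqxx mulf_neq0 ?pnatr_eq0 -?lt0n// subr_eq0 gt_eqF.
move=> k; have [ki|ki] := eqVneq (k \in V1) (i \in V1).
  rewrite (sum_out_const (c := r - alpha * d i)) => [|l Gkl].
    by rewrite (degE _ _ ki) -mulr_natr; ring.
  by move: (bip _ _ Gkl); rewrite ki eq_sym => /negPf ->.
rewrite (sum_out_const (c := (1 - alpha) * d i)) => [|l Gkl].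
  have -> : outdeg G k = outdeg G j.
    by apply: degE; move: ki ij; do 3 case: (_ \in V1).
  rewrite -mulr_natr; apply/eqP; rewrite -subr_eq0; apply/eqP.
  by transitivity ((r - alpha * d i) * (r - alpha * d j)
                   - (1 - alpha) ^+ 2 * (d i * d j)); [ring | rewrite rE subrr].
by rewrite (other _ _ _ Gkl ki) eqxx.
Qed.

End Aalpha.

Lemma lambda_alpha0 (R : realType) (alpha : R) (G : digraph 0) :
  lambda_alpha alpha G = 0.
Proof.
rewrite /lambda_alpha; case: xgetP => // lam _ [/eigenvalueP[v _ /rV0Pn[]]].
by case.
Qed.

Theorem theorem2p4 (R : realType) (alpha : R) (halpha : 0 <= alpha < 1)
    (n : nat) (G : digraph n) (hG : strongly_connected G) :
  lambda_alpha alpha G <= max_arc_bound alpha G /\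
  (outdegree_regular G \/ outdegree_semiregular_bipartite G ->
   lambda_alpha alpha G = max_arc_bound alpha G).
Proof.
have [n0|n0] := posnP n.
  (* Without vertices both sides take their default value 0. *)
  subst n; rewrite lambda_alpha0 /max_arc_bound.
  suff -> : \big[Num.max/0]_(e : 'I_0 * 'I_0 | G e.1 e.2)
              arc_bound alpha G e.1 e.2 = 0 by [].
  by apply: big1_idem => [|[[]]//]; exact: maxxx.
have a1 : alpha < 1 by case/andP: halpha.
have [elam lam0 lam_max] := is_perron_root_real (lambda_alphaP G n0 halpha).
have le_lam : lambda_alpha alpha G <= max_arc_bound alpha G.
  (* A vertex without out-neighbours must be the only vertex; the eigenvalue equation there forces
     [lambda_alpha] to be 0. *)
  have [i /eqP di0|dneq0] := pickP (fun i => outdeg G i == 0)%N; last first.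
    by apply: eigenvalue_le_max_arc_bound => // i; rewrite lt0n dneq0.
  have ni k : k = i.
    apply/esym/eqP/contraT => /(strongly_connected_outdeg_gt0 hG).
    by rewrite di0.
  have /Aalpha_eigenvalueP[x [k]] := elam; rewrite (ni k) => xi /(_ i).
  rewrite di0 mulr0 mul0r big1 => [|j Gij]; last first.
    by have := arc_outdeg_gt0 Gij; rewrite di0.
  rewrite mulr0 addr0 => /eqP; rewrite mulf_eq0 (negPf xi) orbF => /eqP ->.
  exact: max_arc_bound_ge0.
split=> // reg; apply/le_anti; rewrite le_lam /=.
apply: bigmax_le => // -[i j] /= Gij; apply: lam_max.
case: reg => [reg|bip]; first exact: regular_arc_bound_eigenvalue.
apply: semiregular_arc_bound_eigenvalue => //.
(* The path from [j] back to [i] leaves [j], as [i] and [j] differ in the absence of loops. *)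
apply: (strongly_connected_outdeg_gt0 (j := i)) => //.
by apply: contraTneq Gij => ->; rewrite arc_irr.
Qed.
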